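(* Let $G$ be an instance of the Fully Online Matching Problem which admits a matching of size $n$. Then for any $\alpha>0$, \[ \mathbb{P}\left[|M| < (\rho-\alpha)n\right] < e^{-\alpha^2 n}, \] where $M$ is the random variable denoting the matching generated by \textsc{Fully Online Ranking} and $\rho$ is the competitive ratio of \textsc{Fully Online Ranking}.
   Context: Fully Online Matching Problem: $G=(V,E)$ is an undirected (not necessarily bipartite) graph whose vertices arrive and depart online in an adversarial order. When a vertex arrives, all its edges to vertices that have already arrived are revealed; it is guaranteed that by the time a vertex departs, all of its neighbors have arrived (so its entire neighborhood has been revealed). Matching decisions are irrevocable. \textsc{Fully Online Ranking}: when a vertex $i$ arrives, sample an independent uniformly random $x_i\in[0,1]$; when a vertex $i$ departs and is still unmatched, match $i$ to the unmatched neighbor $j\in N(i)$ minimizing $x_j$ (if one exists; ties occur with probability zero). The competitive ratio $\rho$ of \textsc{Fully Online Ranking} is the infimum, over all instances and arrival/departure orders, of the ratio of the expected size of the matching it produces to the size of a maximum matching of the instance. *)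

(* Defs.v *)
From HB Require Import structures.
From mathcomp Require Import all_boot all_order all_algebra.
From mathcomp Require Import all_classical all_reals all_analysis.
Set Implicit Arguments. Unset Strict Implicit. Unset Printing Implicit Defensive.
Import Order.TTheory GRing.Theory Num.Theory.
Local Open Scope ring_scope.

(* Vertices are the naturals 0 .. N-1; the graph is a simple undirected
   graph given by a symmetric irreflexive relation on nat (only its
   restriction to vertices < N matters). The arrival/departure order is a
   sequence of events: (true, v) = arrival of v, (false, v) = departure of v. *)

Definition event_seq (N : nat) : seq (bool * nat) :=
  [seq (true, v) | v <- iota 0 N] ++ [seq (false, v) | v <- iota 0 N].

Definition valid_order (N : nat) (e : rel nat) (s : seq (bool * nat)) : Prop :=
  perm_eq s (event_seq N) /\
  (forall u v, (u < N)%N -> (v < N)%N -> e u v || (u == v) ->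
     (index (true, v) s < index (false, u) s)%N).

Record instance := Instance {
  inst_N : nat;
  inst_e : rel nat;
  inst_s : seq (bool * nat);
  inst_sym : forall u v, inst_e u v = inst_e v u;
  inst_irr : forall u, inst_e u u = false;
  inst_valid : valid_order inst_N inst_e inst_s }.

Definition matching_verts (M : seq (nat * nat)) : seq nat :=
  flatten [seq [:: p.1; p.2] | p <- M].

Definition is_matching (N : nat) (e : rel nat) (M : seq (nat * nat)) : Prop :=
  (forall p, p \in M -> [/\ (p.1 < N)%N, (p.2 < N)%N & e p.1 p.2]) /\
  uniq (matching_verts M).

Definition admits_matching (I : instance) (n : nat) : Prop :=
  exists M, is_matching (inst_N I) (inst_e I) M /\ size M = n.

Definition max_matching_size (I : instance) (n : nat) : Prop :=
  admits_matching I n /\ forall k, admits_matching I k -> (k <= n)%N.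

Section Ranking.
Variable R : realType.

Definition unmatched (M : seq (nat * nat)) (v : nat) : bool :=
  v \notin matching_verts M.

(* the element of a list minimizing x (ties -- a probability-zero event --
   broken in favour of the earliest element) *)
Definition argmin_x (x : nat -> R) (c : seq nat) : option nat :=
  match c with
  | [::] => None
  | j :: c' => Some (foldl (fun b k => if x k < x b then k else b) j c')
  end.

Definition ranking_step (N : nat) (e : rel nat) (x : nat -> R)
    (M : seq (nat * nat)) (ev : bool * nat) : seq (nat * nat) :=
  let: (arr, i) := ev in
  if arr then M
  else if ~~ unmatched M i then M
  else match argmin_x x [seq j <- iota 0 N | e i j && unmatched M j] with
       | Some j => rcons M (i, j)
       | None => M
       end.

Definition ranking (I : instance) (x : nat -> R) : seq (nat * nat) :=
  foldl (ranking_step (inst_N I) (inst_e I) x) [::] (inst_s I).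

(* cube_int n f = integral of f over the ranks x_0..x_{n-1} ∈ [0,1]^n
   (other coordinates fixed to 0), as an iterated Lebesgue integral, i.e.
   expectation with respect to the uniform product distribution. *)
Definition unit_itv : set R := `[(0:R), (1:R)]%classic.

Fixpoint cube_int (n : nat) (f : (nat -> R) -> \bar R) : \bar R :=
  match n with
  | 0 => f (fun _ => 0)
  | n'.+1 => cube_int n' (fun x =>
      (\int[@lebesgue_measure R]_(t in unit_itv)
         f (fun k => if k == n' then t else x k))%E)
  end.

Definition expected_size (I : instance) : \bar R :=
  cube_int (inst_N I) (fun x => ((size (ranking I x))%:R)%:E).

Definition prob (I : instance) (P : (nat -> R) -> bool) : \bar R :=
  cube_int (inst_N I) (fun x => ((P x : nat)%:R)%:E).

Definition comp_ratio : R :=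
  inf [set r : R | exists (I : instance) (opt : nat),
        [/\ max_matching_size I opt, (0 < opt)%N &
            r = fine (expected_size I) / opt%:R]].

End Ranking.

(* Main.v *)
Require Import Defs.
From HB Require Import structures.
From mathcomp Require Import all_boot all_order all_algebra.
From mathcomp Require Import all_classical all_reals all_analysis.
From mathcomp Require Import measurable_realfun.
From mathcomp Require Import zify ring lra.
Import Order.TTheory GRing.Theory Num.Theory.
Local Open Scope ring_scope.
Set Implicit Arguments.
Unset Strict Implicit.

(* Deleting a vertex from the graph makes the sets of available vertices in the
   two runs of Ranking differ in exactly one vertex at any time, so it lowers the
   size of the final matching by 0 or 1. Two consequences: isolating all vertices
   outside a matching of size n only lowers the output; and in the resulting
   instance, whose optimum is n, the output size has bounded differences 1 in the
   ranks of the 2n matched vertices and ignores the other ranks. A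
   McDiarmid-type bound (Hoeffding's lemma, one coordinate at a time) then gives
   exp (- 2 (alpha n)^2 / (2n)). It is applied at the largest integer below
   (rho - alpha) n, which makes the inequality strict. *)

(** * Stability of Ranking under isolating a vertex *)

Section Stability.
Variable R : realType.
Implicit Types (x : nat -> R) (e : rel nat) (M : seq (nat * nat)).

Lemma argmin_rcons x c k :
  argmin_x x (rcons c k) =
  Some (if argmin_x x c is Some j then if x k < x j then k else j else k).
Proof. by case: c => [|j c] //=; rewrite foldl_rcons. Qed.

Lemma argmin_mem x c j : argmin_x x c = Some j -> j \in c.
Proof.
elim/last_ind: c j => [//|c k IH] j; rewrite argmin_rcons mem_rcons inE.
case E: argmin_x => [b|] [<-]; last by rewrite eqxx.
by case: ifP => _; rewrite ?eqxx ?(IH _ E) ?orbT.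
Qed.

Lemma argmin_None x c : argmin_x x c = None -> c = [::].
Proof. by case: c. Qed.

Lemma argmin_le x c j k : argmin_x x c = Some j -> k \in c -> x j <= x k.
Proof.
elim/last_ind: c j => [//|c l IH] j; rewrite argmin_rcons mem_rcons inE.
case E: argmin_x => [b|]; last first.
  by move=> [<-]; rewrite (argmin_None E) in_nil orbF => /eqP ->.
case: ltP => lb [<-] /orP[/eqP->//|kc]; last exact: IH.
exact: le_trans (ltW lb) (IH _ E kc).
Qed.

Lemma argmin_filter x c w j : argmin_x x c = Some j -> j != w ->
  argmin_x x [seq k <- c | k != w] = Some j.
Proof.
elim/last_ind: c j => [//|c k IH] j; rewrite argmin_rcons => -[jE] jw.
rewrite filter_rcons; move: jE.
case E: argmin_x => [b|]; last first.
  by move=> ->; rewrite (argmin_None E) /= jw.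
case: ltP => kb jE.
  (* The filtered prefix may have another minimiser [b'], but [b'] lies in [c], so
     [x k < x b <= x b'] and [k] still wins. *)
  move: jw; rewrite -jE => kw; rewrite kw argmin_rcons.
  case E': argmin_x => [b'|//].
  have := argmin_mem E'; rewrite mem_filter => /andP[_ b'c].
  by rewrite (lt_le_trans kb (argmin_le E b'c)).
move: jw; rewrite -jE => bw; have E' := IH _ E bw.
by case: ifP => _ //; rewrite argmin_rcons E' ltNge kb.
Qed.

Lemma unmatched_rcons M i j u :
  unmatched (rcons M (i, j)) u = [&& unmatched M u, u != i & u != j].
Proof.
rewrite /unmatched /matching_verts map_rcons flatten_rcons mem_cat !inE.
by rewrite !negb_or.
Qed.

(** A departure reads the current matching only through its set of available vertices, so two runs
    can be compared through these sets; [None] covers both an already matched [i] and an empty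
    candidate list. *)
Definition choice_at N e x (A : pred nat) i : option nat :=
  if A i then argmin_x x [seq j <- iota 0 N | e i j && A j] else None.

Definition withdraw (A : pred nat) i (o : option nat) : pred nat :=
  if o is Some j then [pred u | [&& A u, u != i & u != j]] else A.

Lemma ranking_stepE N e x M i :
  ranking_step N e x M (false, i) =
  if choice_at N e x (unmatched M) i is Some j then rcons M (i, j) else M.
Proof. by rewrite /ranking_step /choice_at; case: unmatched. Qed.

(* Departure of [i] when exactly one extra vertex [w] is available in [A]
   compared to [A']: afterwards the two sets again differ in exactly one
   vertex, which may have changed sides. *)
Lemma withdraw_stable N e x (A A' : pred nat) i w :
  (forall u, e u u = false) ->
  (forall u, A u = A' u (+) (u == w)) -> A w ->
  let o := choice_at N e x A i in let o' := choice_at N e x A' i in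
  exists2 w', forall u, withdraw A i o u = withdraw A' i o' u (+) (u == w') &
    (o + withdraw A i o w' = o' + 1)%N.
Proof.
move=> irr AA' Aw o o'.
have A'w : A' w = false by have := AA' w; rewrite Aw eqxx; case: (A' w).
have A'E u : A' u = A u && (u != w).
  case: (eqVneq u w) => [->|uw]; first by rewrite A'w andbF.
  by rewrite AA' (negbTE uw) andbT addbF.
have cE : [seq j <- iota 0 N | e i j && A' j] =
          [seq k <- [seq j <- iota 0 N | e i j && A j] | k != w].
  by rewrite -filter_predI; apply: eq_filter => j /=; rewrite A'E; case: eqP => _;
     rewrite ?andbT ?andbF.
have candP j : argmin_x x [seq j <- iota 0 N | e i j && A j] = Some j ->
    e i j && A j.
  by move=> /argmin_mem; rewrite mem_filter => /andP[].
rewrite /o /o' /choice_at cE.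
(* If the extra vertex itself departs, only the first run can act: its mate [j] becomes the extra
   vertex, now on the other side. *)
have [wi|iw] := eqVneq i w.
  subst w; rewrite A'w Aw; case E: argmin_x => [j|] /=; last by exists i; rewrite ?Aw.
  have /andP[eij Aj] := candP j E.
  exists j; last by rewrite eqxx !andbF.
  move=> u; rewrite A'E; case: (eqVneq u j) => [->|uj]; last by rewrite addbF andbT.
  by rewrite Aj andbF; case: eqP eij => [->|//]; rewrite irr.
rewrite A'E iw andbT; case Ai: (A i); last by exists w; rewrite /= ?Aw.
case E: argmin_x => [j|]; last first.
  by rewrite (argmin_None E) /=; exists w; rewrite /= ?Aw.
have /andP[eij Aj] := candP j E.
have ij : j != i by apply: contraTneq eij => ->; rewrite irr.
(* A choice other than [w] is made in both runs, so [w] remains the extra vertex. *)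
have [jw|jw] := eqVneq j w; last first.
  rewrite (argmin_filter E jw) /=; exists w.
    move=> u; rewrite A'E; case: (eqVneq u w) => [->|_]; last by rewrite andbT addbF.
    by rewrite Aw eq_sym iw eq_sym jw.
  by rewrite Aw eq_sym iw eq_sym jw.
(* The first run takes [w]. The second takes some [k], which stays available in the first only, or
   nothing, and then [i] stays available in the second only. *)
case E': argmin_x => [k|] /=.
  have := argmin_mem E'; rewrite !mem_filter => /andP[kw] /andP[/andP[eik Ak] _].
  have ik : k != i by apply: contraTneq eik => ->; rewrite irr.
  exists k; last by rewrite Ak ik jw kw.
  move=> u; rewrite A'E jw; case: (eqVneq u k) => [->|_]; last first.
    by rewrite addbF andbT; case: eqP; rewrite ?andbT ?andbF.
  by rewrite Ak ik kw.
exists i; last by rewrite eqxx !andbF.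
move=> u; rewrite A'E jw; case: (eqVneq u i) => [->|ui].
  by rewrite Ai iw andbF.
by rewrite /= addbF.
Qed.

(* [w] is the end of the alternating path formed by the symmetric difference of
   the two matchings of sizes [m] and [m']; the side it lies on decides whether
   these sizes agree. *)
Definition one_apart (A A' : pred nat) (m m' : nat) :=
  exists2 w, forall u, A u = A' u (+) (u == w) & (m + A w = m' + 1)%N.

Lemma one_apart_step N e x (A A' : pred nat) i m m' :
  (forall u, e u u = false) -> one_apart A A' m m' ->
  let o := choice_at N e x A i in let o' := choice_at N e x A' i in
  one_apart (withdraw A i o) (withdraw A' i o') (m + o) (m' + o').
Proof.
move=> irr [w AA' mE] o o'; case Aw: (A w).
  have [w' H1 H2] := withdraw_stable N x i irr AA' Aw.
  exists w' => //; move: mE; rewrite Aw => /addIn ->.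
  by rewrite -addnA H2 addnA.
(* Here [w] is available in the second run only, so [withdraw_stable] applies with the runs
   exchanged. *)
have A'w : A' w by have := AA' w; rewrite Aw eqxx; case: (A' w).
have AA u : A' u = A u (+) (u == w) by rewrite AA' -addbA addbb addbF.
have [w' H1 H2] := withdraw_stable N x i irr AA A'w.
exists w'; first by move=> u; rewrite H1 -addbA addbb addbF.
move: mE; rewrite Aw addn0 => ->.
have := H1 w'; rewrite eqxx addbT; move: H2; rewrite -/o -/o'.
move=> H2 H3; move: H2; rewrite H3.
by case: (withdraw A i o w') => /=; lia.
Qed.

(** Deletion removes only the edges at [v], so the vertex set and the order of events are kept. *)
Definition isolate (v : nat) e : rel nat :=
  [rel u w | [&& e u w, u != v & w != v]].

(** An isolated [v] stays unmatched, so it is struck off the available set of its run. At the start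
    the two sets differ exactly in [v], and [one_apart] is then preserved by every event. *)
Lemma ranking_isolate N e x v s : (forall u, e u u = false) ->
  (size (foldl (ranking_step N (isolate v e) x) [::] s)
   <= size (foldl (ranking_step N e x) [::] s)
   <= (size (foldl (ranking_step N (isolate v e) x) [::] s)).+1)%N.
Proof.
set M' := foldl _ _ _; set M := foldl _ _ _ => irr.
suff [w _] : one_apart (unmatched M) [pred u | (u != v) && unmatched M' u]
    (size M) (size M') by case: unmatched; lia.
rewrite {}/M {}/M'; elim/last_ind: s => [|s [arr i] IH].
  exists v => // u; rewrite /= andbT.
  by case: eqP.
rewrite !foldl_rcons; set M := foldl _ _ _ in IH *; set M' := foldl _ _ _ in IH *.
case: arr => //; rewrite !ranking_stepE.
have {IH} := one_apart_step N x i irr IH.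
set A' := [pred u | _]; set o := choice_at N e x _ _.
(* Striking [v] off the available set has the same effect on choices as removing its edges. *)
have -> : choice_at N e x A' i = choice_at N (isolate v e) x (unmatched M') i.
  rewrite /choice_at /A' /isolate /=; case: (eqVneq i v) => [->|iv] /=.
    rewrite (@eq_filter _ _ pred0) ?filter_pred0; first by case: ifP.
    by move=> j /=; rewrite andbF.
  by case: ifP => // _; congr argmin_x; apply: eq_filter => j /=; rewrite andbA.
set o' := choice_at _ _ _ _ _; case=> w H1 H2; exists w.
  move=> u; have := H1 u; rewrite /A'; clear; case: o => [j|]; case: o' => [j'|] /=;
  rewrite ?unmatched_rcons => -> //; congr (_ (+) _); rewrite ?andbA //.
move: H2; clear; case: o => [j|]; case: o' => [j'|] /=;
rewrite ?unmatched_rcons ?size_rcons; lia.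
Qed.

Definition isolate_seq (vs : seq nat) e : rel nat :=
  [rel u w | [&& e u w, u \notin vs & w \notin vs]].

Lemma isolate_seq_cons v vs e :
  isolate_seq (v :: vs) e = isolate v (isolate_seq vs e).
Proof.
apply/funext => u; apply/funext => w; rewrite /isolate_seq /isolate /= !inE.
rewrite !negb_or; case: (e u w); case: (u == v); case: (w == v);
by case: (u \in vs); case: (w \in vs).
Qed.

Lemma ranking_isolate_seq N e x vs s : (forall u, e u u = false) ->
  (size (foldl (ranking_step N (isolate_seq vs e) x) [::] s)
   <= size (foldl (ranking_step N e x) [::] s))%N.
Proof.
move=> irr; elim: vs => [|v vs IH].
  have -> // : isolate_seq [::] e = e.
  by apply/funext => u; apply/funext => w; rewrite /isolate_seq /= !andbT.
apply: leq_trans IH; rewrite isolate_seq_cons.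
have irr' u : isolate_seq vs e u u = false by rewrite /isolate_seq /= irr.
by have /andP[] := ranking_isolate N x v s irr'.
Qed.

Lemma eq_argmin x y c : {in c, x =1 y} -> argmin_x x c = argmin_x y c.
Proof.
elim/last_ind: c => [//|c k IH] xy; rewrite !argmin_rcons IH; last first.
  by move=> j jc; rewrite xy // mem_rcons inE jc orbT.
case E: argmin_x => [b|//]; rewrite !xy //.
  by rewrite mem_rcons inE (argmin_mem E) orbT.
by rewrite mem_rcons mem_head.
Qed.

(** A vertex without incoming edges is never a candidate, so its rank is never compared. *)
Lemma ranking_isolated N e x y v s : (forall u, e u v = false) ->
  (forall k, k != v -> x k = y k) ->
  foldl (ranking_step N e x) [::] s = foldl (ranking_step N e y) [::] s.
Proof.
move=> ev xy; congr (foldl _ _ _); apply/funext => M; apply/funext => -[arr i].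
rewrite /ranking_step; case: ifP => // _; case: ifP => // _.
rewrite (@eq_argmin x y) // => j; rewrite mem_filter => /andP[/andP[eij _] _].
by apply: xy; apply: contraTneq eij => ->; rewrite ev.
Qed.

(** Each event adds at most one edge; this crude bound serves to make the output size integrable. *)
Lemma size_ranking_le N e x s :
  (size (foldl (ranking_step N e x) [::] s) <= size s)%N.
Proof.
elim/last_ind: s => [//|s [arr i] IH]; rewrite foldl_rcons size_rcons.
apply: (@leq_trans (size (foldl (ranking_step N e x) [::] s)).+1) => //.
move: (foldl _ _ _) => M; case: arr => //; rewrite ranking_stepE.
by case: choice_at => [j|] //; rewrite size_rcons.
Qed.

End Stability.

(** * Hoeffding's lemma for two-point distributions *)

Section Hoeffding.
Variable R : realType.

Lemma ge0_is_derive_le (f f' : R -> R) :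
  (forall x : R, is_derive x 1 f (f' x)) -> (forall x, 0 <= x -> 0 <= f' x) ->
  forall x, 0 <= x -> f 0 <= f x.
Proof.
move=> df f'0 x x0.
have dv y : derivable f (y : R) 1 by have [] := df y.
apply: (@ger0_derive1_ndecr _ f 0 x) => //.
- move=> y; rewrite in_itv /= => /andP[/ltW y0 _].
  by rewrite derive1E (@derive_val _ _ _ _ _ _ _ (df y)) f'0.
- by apply: derivable_within_continuous.
Qed.

(** The left side is the moment generating function of a Bernoulli variable. The gap [h] between the
    two logarithms and its derivative [k] vanish at 0, and the derivative [k'] of [k] is
    nonnegative. *)
Lemma hoeffding_two_point (p s : R) : 0 <= p <= 1 -> 0 <= s ->
  1 - p + p * expR s <= expR (p * s + s ^+ 2 / 8).
Proof.
move=> /andP[p0 p1] s0.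
pose D (s : R) : R := 1 - p + p * expR s.
have D0 x : 0 < D x by rewrite /D; have := expR_gt0 x; nra.
have dD (x : R) : is_derive x 1 D (p * expR x).
  rewrite /D; apply: is_derive_eq; rewrite /GRing.scale /=. ring.
pose k (s : R) : R := p + s / 4 - p * expR s / D s.
have k_ge0 x : 0 <= x -> 0 <= k x.
  move=> x0; have -> : 0 = k 0 by rewrite /k /D expR0 mulr1 subrK divr1; ring.
  pose k' (x : R) : R := 4^-1 - p * expR x * (1 - p) / D x ^+ 2.
  apply: (@ge0_is_derive_le k k' _ _ x x0) => y.
    rewrite /k; have Dy0 : D y != 0 by rewrite gt_eqF.
    have dDV := is_deriveV Dy0 (dD y).
    apply: is_derive_eq; rewrite /GRing.scale /= /k'.
    by clear dDV; move: Dy0; rewrite /D; move: (expR y) => E Dy0; field.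
  move=> _; rewrite /k' subr_ge0 ler_pdivrMr ?exprn_gt0// /D.
  move: (expR y) => E.
  (* The inequality of arithmetic and geometric means for [1 - p] and [p * E]. *)
  have -> : 4^-1 * (1 - p + p * E) ^+ 2 =
    4^-1 * (1 - p - p * E) ^+ 2 + p * E * (1 - p) by field.
  by rewrite lerDr mulr_ge0 ?sqr_ge0.
pose h (s : R) : R := p * s + s ^+ 2 / 8 - ln (D s).
suff : 0 <= h s.
  rewrite /h subr_ge0 => hs; rewrite -/(D s) -[D s]lnK ?posrE ?D0//.
  by rewrite ler_expR.
have -> : 0 = h 0 by rewrite /h /D expR0 (_ : 1 - p + _ = 1) ?ln1; ring.
apply: (@ge0_is_derive_le h k _ k_ge0 s s0) => y.
have dl := is_derive1_comp (is_derive1_ln (D0 y)) (dD y).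
rewrite -[h]/((fun s : R => p * s + s ^+ 2 / 8) - (@ln R \o D)).
apply: is_derive_eq; rewrite /GRing.scale /= /k.
by have := gt_eqF (D0 y); move: (D y) => d; clear => /negbT d0; field.
Qed.

(** Convexity; on taking means it replaces a variable in the unit interval by a Bernoulli variable
    of equal mean. *)
Lemma expR_chord (u s : R) : 0 <= u <= 1 ->
  expR (- (s * u)) <= 1 - u + u * expR (- s).
Proof.
move=> /andP[u0 u1].
have := convex_expR (Itv01 u0 u1) (- s) 0.
rewrite !convRE /= expR0 => h; apply: (le_trans _ (le_trans h _)).
  by rewrite ler_expR mulr0 addr0 mulrN mulrC.
by rewrite /unstable.onem /=; lra.
Qed.

(** The form for lower tails: apply the positive one to the complementary variable of mean [1 - p]
    and multiply by [expR (- s)]. *)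
Lemma hoeffding_two_point_neg (p s : R) : 0 <= p <= 1 -> 0 <= s ->
  1 - p + p * expR (- s) <= expR (- (s * p) + s ^+ 2 / 8).
Proof.
move=> /andP[p0 p1] s0.
have q01 : 0 <= 1 - p <= 1 by apply/andP; split; lra.
have := hoeffding_two_point q01 s0.
rewrite -(ler_pM2l (expR_gt0 (- s))) -expRD => h.
apply: (le_trans (le_trans _ h)); last by rewrite ler_expR; lra.
by rewrite mulrDr (mulrCA _ (1 - p)) -expRD addNr expR0; lra.
Qed.
End Hoeffding.

(** * Iterated means over the cube and a bounded difference inequality *)

Section CubeMean.
Variable R : realType.
Implicit Types (x : nat -> R) (f g : (nat -> R) -> R).
Let mu := @lebesgue_measure R.
Let I01 : set R := @unit_itv R.

Definition upd x n (t : R) : nat -> R := fun k => if k == n then t else x k.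

(* Measurability along every measurable parametrization replaces a sigma-algebra
   on [nat -> R]; it is stable under partial integration by Tonelli on [T * R]. *)
Definition bounded_measurable f : Prop :=
  (forall d (T : measurableType d) (phi : nat -> T -> R),
    (forall k, measurable_fun setT (phi k)) ->
    measurable_fun setT (fun t => f (phi^~ t))) /\
  exists K, forall x, 0 <= f x <= K.

Definition avg n f x : R := (\int[mu]_(t in I01) f (upd x n t))%R.

(** The real-valued counterpart of [cube_int], with the same order of integration, so that
    exponential estimates stay in [R]. *)
Fixpoint mean n f : R :=
  if n is n'.+1 then mean n' (avg n' f) else f (fun=> 0).

Lemma measurable_I01 : measurable (I01 : set (measurableTypeR R)).
Proof. exact: measurable_itv. Qed.

Lemma mu_I01 : mu I01 = 1%:E.
Proof.
by rewrite /mu /I01 /unit_itv lebesgue_measure_itv /= lte_fin ltr01 oppr0 adde0.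
Qed.

Lemma bounded_measurable_slice f x n : bounded_measurable f ->
  measurable_fun setT (fun t : measurableTypeR R => f (upd x n t)).
Proof.
move=> [mf _].
apply: (mf _ (measurableTypeR R) (fun k t => upd x n t k)) => k.
rewrite /upd; case: eqP => _; [exact: measurable_id|exact: measurable_cst].
Qed.

Lemma bounded_measurable_integrable f x n : bounded_measurable f ->
  mu.-integrable I01 (EFin \o (fun t => f (upd x n t))).
Proof.
move=> bf; apply: measurable_bounded_integrable.
- exact: measurable_I01.
- by rewrite [X in (X < _)%E]mu_I01 ltry.
- exact: measurable_funTS (bounded_measurable_slice x n bf).
- case: bf => _ [K fK]; exists K; split; first by rewrite num_real.
  move=> M KM t _ /=; have /andP[f0 fle] := fK (upd x n t).
  by rewrite ger0_norm// (le_trans fle)// ltW.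
Qed.

Lemma EFin_avg n f x : bounded_measurable f ->
  (avg n f x)%:E = (\int[mu]_(t in I01) (f (upd x n t))%:E)%E.
Proof.
move=> bf; rewrite /avg /Rintegral fineK//.
exact: (integrable_fin_num measurable_I01 (bounded_measurable_integrable x n bf)).
Qed.

Lemma avg_cst n x (r : R) : avg n (fun=> r) x = r.
Proof.
rewrite /avg Rintegral_cst; last exact: measurable_I01.
by rewrite [X in fine X]mu_I01 mulr1.
Qed.

Lemma bounded_measurable_cst (r : R) : 0 <= r -> bounded_measurable (fun=> r).
Proof.
move=> r0; split; last by exists r => _; rewrite r0 /=.
by move=> d T phi _; exact: measurable_cst.
Qed.

Lemma le_avg n f g x : bounded_measurable f -> bounded_measurable g ->
  (forall t, f (upd x n t) <= g (upd x n t)) -> avg n f x <= avg n g x.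
Proof.
move=> bf bg fg; apply: le_Rintegral => //.
- exact: measurable_I01.
- exact: bounded_measurable_integrable.
- exact: bounded_measurable_integrable.
Qed.

Lemma avgZ n f (r : R) x : bounded_measurable f ->
  avg n (fun y => r * f y) x = r * avg n f x.
Proof.
move=> bf; apply: RintegralZl; first exact: measurable_I01.
exact: (bounded_measurable_integrable x n bf).
Qed.

Lemma bounded_measurableD f (r : R) : 0 <= r -> bounded_measurable f ->
  bounded_measurable (fun x => f x + r).
Proof.
move=> r0 [mf [K fK]]; split; last first.
  by exists (K + r) => x; have /andP[f0 fle] := fK x; rewrite addr_ge0//= lerD2r.
move=> d T phi mphi; apply: measurable_funD; [exact: mf|exact: measurable_cst].
Qed.

Lemma avgDr n f (r : R) x : 0 <= r -> bounded_measurable f ->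
  avg n (fun y => f y + r) x = avg n f x + r.
Proof.
move=> r0 bf; rewrite -[in RHS](avg_cst n x r); apply: RintegralD.
- exact: measurable_I01.
- exact: bounded_measurable_integrable.
- exact: (bounded_measurable_integrable x n (bounded_measurable_cst r0)).
Qed.

Lemma bounded_measurable_avg n f : bounded_measurable f ->
  bounded_measurable (avg n f).
Proof.
move=> bf; have [mf [K fK]] := bf; split; last first.
  exists K => x; have K0 : 0 <= K by have /andP[/le_trans h /h] := fK x.
  have bK := bounded_measurable_cst K0; have b0 := bounded_measurable_cst (lexx 0).
  rewrite -(avg_cst n x K) -[0](avg_cst n x 0) !le_avg// => t;
  by have /andP[] := fK (upd x n t).
move=> d T phi mphi; apply/measurable_EFinP.
pose F (z : T * measurableTypeR R) : \bar R := (f (upd (phi^~ z.1) n z.2))%:E.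
have mF : measurable_fun setT F.
  apply/measurable_EFinP.
  apply: (mf _ _ (fun k (z : T * measurableTypeR R) => upd (phi^~ z.1) n z.2 k)) => k.
  rewrite /upd; case: eqP => _; first exact: measurable_snd.
  exact: measurableT_comp (mphi k) measurable_fst.
have F0 z : (0 <= F z)%E by rewrite lee_fin; have /andP[] := fK (upd (phi^~ z.1) n z.2).
(* Tonelli is applied with the uniform probability on the unit interval; [integral_uniform] turns it
   back into a Lebesgue integral over [I01]. *)
have := @measurable_fun_fubini_tonelli_F _ _ _ _ R (uniform_prob (@ltr01 R)) F mF F0.
congr measurable_fun; apply/funext => t; rewrite /fubini_F integral_uniform.
- by rewrite subr0 invr1 mul1e /= EFin_avg.
- exact: (measurableT_comp mF (measurable_pair1 t)).
- by move=> r; exact: F0.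
Qed.

Lemma cube_intE n f : bounded_measurable f ->
  cube_int n (fun x => (f x)%:E) = (mean n f)%:E.
Proof.
elim: n f => [//|n IH] f bf /=; rewrite -IH; last exact: bounded_measurable_avg.
by congr cube_int; apply/funext => x; rewrite EFin_avg.
Qed.

Lemma le_mean n f g : bounded_measurable f -> bounded_measurable g ->
  (forall x, f x <= g x) -> mean n f <= mean n g.
Proof.
elim: n f g => [|n IH] f g bf bg fg /=; first exact: fg.
apply: IH; [exact: bounded_measurable_avg..|].
by move=> x; apply: le_avg => // t; exact: fg.
Qed.

Lemma meanZ n f (r : R) : bounded_measurable f ->
  mean n (fun y => r * f y) = r * mean n f.
Proof.
elim: n f => [//|n IH] f bf /=; rewrite -IH; last exact: bounded_measurable_avg.
by congr mean; apply/funext => x; rewrite avgZ.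
Qed.

Lemma mean_cst n (r : R) : mean n (fun=> r) = r.
Proof.
elim: n => [//|n IH] /=; rewrite -[RHS]IH.
by congr mean; apply/funext => x; rewrite avg_cst.
Qed.

Lemma bounded_measurableZ f (r : R) : 0 <= r -> bounded_measurable f ->
  bounded_measurable (fun x => r * f x).
Proof.
move=> r0 [mf [K fK]]; split; last first.
  exists (r * K) => x; have /andP[f0 fle] := fK x.
  by rewrite mulr_ge0//= ler_wpM2l.
move=> d T phi mphi; apply: measurable_funM; [exact: measurable_cst|exact: mf].
Qed.

Lemma bounded_measurable_expR f (s : R) : 0 <= s -> bounded_measurable f ->
  bounded_measurable (fun x => expR (- (s * f x))).
Proof.
move=> s0 [mf [K fK]]; split; last first.
  exists 1 => x; have /andP[f0 _] := fK x.
  by rewrite expR_ge0/= -[1](@expR0 R) ler_expR oppr_le0 mulr_ge0.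
move=> d T phi mphi; apply: (measurableT_comp (@measurable_expR R)).
apply: (@measurable_funN _ _ _ _ (fun t => s * f (phi^~ t))).
by apply: measurable_funM; [exact: measurable_cst|exact: mf].
Qed.

(** With [a] the infimum of [h], oscillation at most 1 confines [h] to [[a, a + 1]]; the chord bound
    then reduces to the two-point case with [p = m - a]. *)
Lemma hoeffding (h : R -> R) (s : R) : 0 <= s ->
  measurable_fun setT (h : measurableTypeR R -> R) ->
  (forall t, 0 <= h t) -> (forall t u, h t <= h u + 1) ->
  (\int[mu]_(t in I01) expR (- (s * h t)) <=
   expR (- (s * \int[mu]_(t in I01) h t) + s ^+ 2 / 8))%R.
Proof.
move=> s0 mh h0 h1.
have int (k : R -> R) (K : R) : measurable_fun setT (k : measurableTypeR R -> R) ->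
    (forall t, `|k t| <= K) -> mu.-integrable I01 (EFin \o k).
  move=> mk kK; apply: measurable_bounded_integrable.
  - exact: measurable_I01.
  - by rewrite [X in (X < _)%E]mu_I01 ltry.
  - exact: measurable_funTS mk.
  - exists K; split; first by rewrite num_real.
    by move=> M KM t _ /=; rewrite (le_trans (kK t))// ltW.
have intc (r : R) (k : R -> R) : mu.-integrable I01 (EFin \o k) ->
    mu.-integrable I01 (EFin \o (fun t => r * k t)).
  by move=> ik; exact: (integrableZl measurable_I01 r ik).
have cst (r : R) : (\int[mu]_(t in I01) r = r)%R.
  by rewrite Rintegral_cst ?[X in fine X]mu_I01 ?mulr1//; exact: measurable_I01.
have icst (r : R) : mu.-integrable I01 (EFin \o (fun=> r)).
  by apply: (int _ `|r|); [exact: measurable_cst|].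
pose a := inf (range h).
have hl : has_lbound (range h) by exists 0 => _ [t _ <-].
have ah t : a <= h t by apply: ge_inf => //; exists t.
have ha t : h t <= a + 1.
  rewrite -lerBlDr; apply: lb_le_inf; first by exists (h 0), 0.
  by move=> _ [u _ <-]; rewrite lerBlDr.
have ih : mu.-integrable I01 (EFin \o h).
  apply: (int _ (a + 1)) => // t; by rewrite ger0_norm.
pose m := (\int[mu]_(t in I01) h t)%R.
have p01 : 0 <= m - a <= 1.
  rewrite subr_ge0 lerBlDr (addrC 1) -{1}[a]cst -[a + 1]cst.
  by rewrite !le_Rintegral//; exact: measurable_I01.
(* [c0 + c1 * y] is the chord of [expR (- (s * y))] over [[a, a + 1]]. *)
pose c0 := expR (- (s * a)) * (1 + a - a * expR (- s)).
pose c1 := expR (- (s * a)) * (expR (- s) - 1).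
apply: (@le_trans _ _ (\int[mu]_(t in I01) (c0 + c1 * h t))%R).
  apply: le_Rintegral; first exact: measurable_I01.
  - apply: (int _ 1) => [|t].
      apply: (measurableT_comp (@measurable_expR R)).
      apply: (@measurable_funN _ _ _ _ (fun t => s * h t)).
      by apply: measurable_funM => //; exact: measurable_cst.
    by rewrite ger0_norm ?expR_ge0// -[1](@expR0 R) ler_expR oppr_le0 mulr_ge0.
  - exact: (integrableD measurable_I01 (icst c0) (intc c1 _ ih)).
  - move=> t _; have u01 : 0 <= h t - a <= 1.
      by rewrite subr_ge0 ah lerBlDr addrC ha.
    have := expR_chord s u01; rewrite -(ler_pM2l (expR_gt0 (- (s * a)))) -expRD.
    rewrite (_ : - (s * a) + - (s * (h t - a)) = - (s * h t)); last by ring.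
    move=> /le_trans; apply; rewrite /c0 /c1 le_eqVlt.
    by apply/orP; left; apply/eqP; ring.
rewrite RintegralD//; [|exact: measurable_I01|exact: intc].
rewrite cst RintegralZl//; last exact: measurable_I01.
rewrite -/m (_ : c0 + c1 * m =
  expR (- (s * a)) * (1 - (m - a) + (m - a) * expR (- s))); last first.
  by rewrite /c0 /c1; ring.
rewrite (_ : - (s * m) + _ = - (s * a) + (- (s * (m - a)) + s ^+ 2 / 8)); last by ring.
by rewrite expRD ler_pM2l ?expR_gt0// hoeffding_two_point_neg.
Qed.

(** Integrate out the last coordinate: Hoeffding's lemma costs a factor [expR (s ^+ 2 / 8)] if [c n]
    holds and nothing otherwise. Induction applies to [avg n f], which inherits the bounded
    differences. *)
Lemma mean_expR_bounded_difference n f (c : nat -> bool) (s : R) :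
  0 <= s -> bounded_measurable f ->
  (forall x k t u, (k < n)%N -> f (upd x k t) <= f (upd x k u) + (c k)%:R) ->
  mean n (fun x => expR (- (s * f x))) <=
  expR (- (s * mean n f) + s ^+ 2 / 8 * (\sum_(k < n) c k)%:R).
Proof.
move=> s0; elim: n f => [|n IH] f bf df /=; first by rewrite big_ord0 mulr0 addr0.
have bexp := bounded_measurable_expR s0 bf.
have bavg := bounded_measurable_avg n bf.
pose e := expR (s ^+ 2 / 8 * (c n)%:R).
have step x : avg n (fun x => expR (- (s * f x))) x <= e * expR (- (s * avg n f x)).
  rewrite /e -expRD; have dn t u := df x n t u (ltnSn n).
  case: (c n) dn => /= dn.
    rewrite mulr1 addrC; apply: (@hoeffding (fun t => f (upd x n t))) => //.
    - exact: bounded_measurable_slice.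
    - by move=> t; have [_ [K /(_ (upd x n t)) /andP[]]] := bf.
  (* If [c n] is false, [f] is constant in coordinate [n], so averaging commutes with the
     exponential. *)
  have fE t : f (upd x n t) = f (upd x n 0).
    by apply/eqP; rewrite eq_le; move: (dn t 0) (dn 0 t); rewrite !addr0 => -> ->.
  have avgE (q : R -> R) : avg n (fun y => q (f y)) x = q (f (upd x n 0)).
    by rewrite -[RHS](avg_cst n x); apply: eq_Rintegral => t _; rewrite fE.
  by rewrite mulr0 add0r (avgE (fun y => expR (- (s * y)))) (avgE id).
apply: (le_trans (le_mean n _ _ step)).
- exact: bounded_measurable_avg.
- by apply: bounded_measurableZ; [exact: expR_ge0|exact: bounded_measurable_expR].
rewrite meanZ; last exact: bounded_measurable_expR.
rewrite big_ord_recr /= natrD mulrDr addrA [leRHS]expRD -/e mulrC.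
rewrite ler_wpM2r ?expR_ge0//; apply: IH => // x k t u kn.
rewrite -(avgDr n _ (ler0n _ _) bf) /avg.
(* Since [k < n], the two updates commute and the difference bound passes under the integral. *)
have updC y v : upd (upd x k v) n y = upd (upd x n y) k v.
  by apply/funext => i; rewrite /upd; case: eqP => // ->; rewrite gtn_eqF.
apply: le_Rintegral; first exact: measurable_I01.
- exact: bounded_measurable_integrable.
- exact: (bounded_measurable_integrable _ n (bounded_measurableD (ler0n _ _) bf)).
- by move=> y _; rewrite !updC df// ltnW.
Qed.

End CubeMean.

(** * Measurability of the output of Ranking in the ranks *)

Section RankingMeasurable.
Local Open Scope classical_set_scope.
Variables (R : realType) (d : measure_display) (T : measurableType d).
Variable phi : nat -> T -> R.
Hypothesis mphi : forall k, measurable_fun setT (phi k).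

Definition discrete_measurable (X : Type) (F : T -> X) :=
  forall Y : set X, measurable (F @^-1` Y).

Lemma discrete_measurable_cst (X : Type) (a : X) : discrete_measurable (fun=> a).
Proof.
move=> Y; have [Ya|Ya] := pselect (Y a).
  by rewrite (_ : _ @^-1` _ = setT)//; apply/seteqP; split.
by rewrite (_ : _ @^-1` _ = set0)//; apply/seteqP; split.
Qed.

(** Split along the countably many values of [F]. This follows the control flow of the algorithm,
    whose states are countable and whose only contact with the ranks is comparison. *)
Lemma discrete_measurable_bind (X : countType) (Z : Type) (F : T -> X)
    (G : X -> T -> Z) : discrete_measurable F ->
  (forall a, discrete_measurable (G a)) ->
  discrete_measurable (fun t => G (F t) t).
Proof.
move=> mF mG Y.
rewrite (_ : _ @^-1` _ = \bigcup_a (F @^-1` [set a] `&` G a @^-1` Y)); last first.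
  apply/seteqP; split => t /=; first by move=> Yt; exists (F t).
  by move=> [a _ /= [-> ]].
apply: countable_bigcupT_measurable; first exact: countableP.
by move=> a; apply: measurableI; [exact: mF|exact: mG].
Qed.

Lemma discrete_measurable_lt j k : discrete_measurable (fun t => phi k t < phi j t).
Proof.
move=> Y; rewrite -[_ @^-1` _]setTI.
by apply: (measurable_fun_ltr (mphi k) (mphi j)) => //.
Qed.

Lemma discrete_measurable_foldl (X : countType) (E : Type)
    (op : T -> X -> E -> X) (a : X) (s : seq E) :
  (forall b i, discrete_measurable (fun t => op t b i)) ->
  discrete_measurable (fun t => foldl (op t) a s).
Proof.
move=> mop; elim/last_ind: s => [|s i IH]; first exact: discrete_measurable_cst.
under eq_fun do rewrite foldl_rcons.
by apply: (@discrete_measurable_bind X X _ (fun b t => op t b i)).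
Qed.

Lemma discrete_measurable_argmin c :
  discrete_measurable (fun t => argmin_x (phi^~ t) c).
Proof.
case: c => [|j c] /=; first exact: discrete_measurable_cst.
apply: (@discrete_measurable_bind nat _ _ (fun b _ => Some b)); last first.
  by move=> b; exact: discrete_measurable_cst.
apply: (@discrete_measurable_foldl nat nat
  (fun t b k => if phi k t < phi b t then k else b)) => b k.
apply: (@discrete_measurable_bind bool nat _ (fun l _ => if l then k else b)).
  exact: discrete_measurable_lt.
by move=> l; exact: discrete_measurable_cst.
Qed.

Lemma discrete_measurable_ranking I :
  discrete_measurable (fun t => ranking I (phi^~ t)).
Proof.
apply: (@discrete_measurable_foldl _ (bool * nat)%type
  (fun t => ranking_step (inst_N I) (inst_e I) (phi^~ t))) => M [arr i].
rewrite /ranking_step; case: arr; first exact: discrete_measurable_cst.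
case: (~~ unmatched M i); first exact: discrete_measurable_cst.
apply: (@discrete_measurable_bind _ _ _
  (fun o _ => if o is Some j then rcons M (i, j) else M)).
  exact: discrete_measurable_argmin.
by move=> o; exact: discrete_measurable_cst.
Qed.

End RankingMeasurable.

(** A general [h] covers both the output size and the indicators of tail events. *)
Lemma bounded_measurable_ranking (R : realType) I (h : seq (nat * nat) -> R) (K : R) :
  (forall x : nat -> R, 0 <= h (ranking I x) <= K) ->
  bounded_measurable (fun x : nat -> R => h (ranking I x)).
Proof.
move=> hK; split; last by exists K.
move=> d T phi mphi _ Y mY; rewrite setTI.
exact: (discrete_measurable_ranking mphi I (h @^-1` Y)%classic).
Qed.

Lemma bounded_measurable_size (R : realType) I :
  bounded_measurable (fun x : nat -> R => (size (ranking I x))%:R).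
Proof.
apply: (@bounded_measurable_ranking _ _ (fun M => (size M)%:R)
  (size (inst_s I))%:R) => x.
by rewrite ler0n ler_nat size_ranking_le.
Qed.

(** * The instance with all vertices outside a matching isolated *)

Section IsolateInstance.
Variables (vs : seq nat) (I : instance).

Let e' := isolate_seq vs (inst_e I).

Fact isolate_sym u v : e' u v = e' v u.
Proof. by rewrite /e' /isolate_seq /= inst_sym andbA andbAC -andbA. Qed.

Fact isolate_irr u : e' u u = false.
Proof. by rewrite /e' /isolate_seq /= inst_irr. Qed.

Fact isolate_valid : valid_order (inst_N I) e' (inst_s I).
Proof.
have [pe ord] := inst_valid I; split => // u v uN vN euv; apply: ord => //.
by case/orP: euv => [/andP[-> //]|->]; rewrite ?orbT.
Qed.

Definition isolate_instance := Instance isolate_sym isolate_irr isolate_valid.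

End IsolateInstance.

Lemma size_matching_verts M : size (matching_verts M) = (size M).*2.
Proof. by elim: M => [//|p M IH]; rewrite /= -[flatten _]/(matching_verts M) IH. Qed.

Section Matched.
Variables (I : instance) (M : seq (nat * nat)).
Hypothesis mM : is_matching (inst_N I) (inst_e I) M.

Let S := matching_verts M.
Let J := isolate_instance [seq v <- iota 0 (inst_N I) | v \notin S] I.

Lemma matching_verts_lt v : v \in S -> (v < inst_N I)%N.
Proof.
by case/flattenP => _ /mapP[p /(mM.1) [p1 p2 _] ->]; rewrite !inE => /orP[]/eqP->.
Qed.

(** [M] survives since its vertices keep their mutual edges; every matching of [J] uses only
    vertices of [S], and there are twice [size M] of these. *)
Lemma max_matching_isolated : max_matching_size J (size M).
Proof.
have inS v : v \in S -> v \notin [seq v <- iota 0 (inst_N I) | v \notin S].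
  by rewrite mem_filter => ->.
split.
  exists M; split=> //; split; last exact: mM.2.
  move=> p pM; have [p1 p2 ep] := mM.1 p pM; split=> //=.
  have sub v : v \in [:: p.1; p.2] -> v \in S.
    by move=> vp; apply/flattenP; exists [:: p.1; p.2] => //; exact: map_f.
  by rewrite /isolate_seq /= ep !inS// sub// !inE eqxx ?orbT.
move=> k [M2 [[eM2 uM2] <-]].
rewrite -leq_double -!size_matching_verts; apply: uniq_leq_size => // v.
case/flattenP => _ /mapP[p /eM2 [p1 p2 /and3P[_ n1 n2]] ->].
rewrite !mem_filter !mem_iota !add0n !leq0n p1 p2 !andbT !negbK in n1 n2.
by rewrite !inE => /orP[]/eqP->.
Qed.

Lemma size_ranking_isolated (R : realType) (x : nat -> R) :
  (size (ranking J x) <= size (ranking I x))%N.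
Proof. exact: (ranking_isolate_seq _ _ _ _ (@inst_irr I)). Qed.

(** For [k] in [S], both sizes are compared with the run where [k] is isolated as well: it ignores
    the rank of [k] and falls short by at most one. Other [k] are already isolated in [J]. *)
Lemma ranking_bounded_difference (R : realType) (x : nat -> R) k t u :
  (k < inst_N I)%N ->
  (size (ranking J (upd x k t)) <= size (ranking J (upd x k u)) + (k \in S))%N.
Proof.
move=> kN; have xE i : i != k -> upd x k t i = upd x k u i.
  by rewrite /upd => /negbTE ->.
case kS: (k \in S); last first.
  rewrite addn0 /ranking (@ranking_isolated _ _ _ (upd x k t) (upd x k u) k)// => v.
  by rewrite /J /= /isolate_seq /= !mem_filter !mem_iota !add0n kN kS !andbF.
have iso (v : nat -> R) := ranking_isolate (inst_N I) v k (inst_s I) (@inst_irr J).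
have /andP[_ h1] := iso (upd x k t); have /andP[h2 _] := iso (upd x k u).
rewrite addn1; apply: (leq_trans h1); rewrite ltnS; apply: leq_trans h2.
rewrite (@ranking_isolated _ _ _ (upd x k t) (upd x k u) k)// => v.
by rewrite /isolate /= eqxx !andbF.
Qed.

Lemma sum_matching_verts : (\sum_(k < inst_N I) ((k : nat) \in S) = (size M).*2)%N.
Proof.
rewrite -size_matching_verts -/S -(big_mkord xpredT (fun k => (k \in S) : nat)).
rewrite (eq_bigr (fun k => if k \in S then 1 else 0)%N); last by move=> k _; case: ifP.
rewrite -big_mkcond sum1_count /index_iota subn0 -size_filter.
apply/perm_size/uniq_perm.
- by rewrite filter_uniq// iota_uniq.
- exact: mM.2.
- move=> v; rewrite mem_filter mem_iota add0n leq0n /=.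
  by case vS: (v \in S) => //=; exact: matching_verts_lt.
Qed.

End Matched.

(** * Competitive ratio, Chernoff bound and conclusion *)

Lemma comp_ratio_le (R : realType) (I : instance) (opt : nat) :
  max_matching_size I opt -> (0 < opt)%N ->
  comp_ratio R * opt%:R <=
  mean (inst_N I) (fun x : nat -> R => (size (ranking I x))%:R).
Proof.
move=> mI opt0; have o0 : 0 < opt%:R :> R by rewrite ltr0n.
have size_bm := @bounded_measurable_size R.
rewrite -ler_pdivlMr//; apply: ge_inf.
  (* The infimum is a genuine lower bound because the ratios are bounded below by 0. *)
  exists 0 => _ [J [k [_ k0 ->]]].
  rewrite /expected_size cube_intE//= divr_ge0//.
  rewrite -[0](mean_cst (inst_N J)); apply: le_mean => //.
  exact: bounded_measurable_cst.
by exists I, opt; split => //; rewrite /expected_size cube_intE.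
Qed.

(** Chernoff's method with free parameter [s]: as [f], the output size on [J], is at most that on
    [I], the indicator is dominated by [expR (s * (b - f))]. *)
Lemma ranking_lower_tail (R : realType) (I : instance) (M : seq (nat * nat)) (b s : R) :
  is_matching (inst_N I) (inst_e I) M -> (0 < size M)%N -> 0 <= s ->
  mean (inst_N I) (fun x : nat -> R => ((size (ranking I x))%:R <= b)%R%:R) <=
  expR (s * b - s * (comp_ratio R * (size M)%:R) + s ^+ 2 / 4 * (size M)%:R).
Proof.
move=> mM M0 s0; set N := inst_N I.
have maxM := max_matching_isolated mM.
set J := isolate_instance _ I in maxM.
pose f (x : nat -> R) : R := (size (ranking J x))%:R.
have bf : bounded_measurable f by exact: bounded_measurable_size.
have bexp := bounded_measurable_expR s0 bf.
apply: (@le_trans _ _ (mean N (fun x => expR (s * b) * expR (- (s * f x))))).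
  apply: le_mean.
  - apply: (@bounded_measurable_ranking R I (fun M => ((size M)%:R <= b)%R%:R) 1) => x.
    by rewrite /= ler0n lern1 leq_b1.
  - by apply: bounded_measurableZ => //; exact: expR_ge0.
  - move=> x; case: (leP (size (ranking I x))%:R b) => [fb|_] /=;
      last by rewrite mulr_ge0 ?expR_ge0.
    rewrite -expRD -[leLHS](@expR0 R) ler_expR subr_ge0 ler_wpM2l//.
    apply: le_trans fb; rewrite ler_nat.
    exact: size_ranking_isolated.
rewrite meanZ// -addrA expRD ler_pM2l ?expR_gt0//.
apply: (le_trans (@mean_expR_bounded_difference R N f
  (fun k => k \in matching_verts M) s s0 bf _)).
  by move=> x k t u kN; rewrite -natrD ler_nat; exact: ranking_bounded_difference.
(* Twice [size M] coordinates matter, which turns [s ^+ 2 / 8] into [s ^+ 2 / 4]. The optimum of [J]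
   is exactly [size M], so the mean of [f] is at least [comp_ratio R] times it. *)
rewrite ler_expR (sum_matching_verts mM) -muln2 natrM.
have := comp_ratio_le R maxM M0; rewrite -/f -/N => h.
have := ler_wpM2l s0 h; lra.
Qed.

Theorem theorem2 (R : realType) (I : instance) (n : nat) (alpha : R) :
  admits_matching I n -> 0 < alpha ->
  (prob I (fun x : nat -> R =>
     ((size (ranking I x))%:R < (comp_ratio R - alpha) * n%:R)%R)
   < (expR (- (alpha ^+ 2 * n%:R)))%:E)%E.
Proof.
move=> [M [mM <-]] a0; set a := _ * _; set m : R := (size M)%:R.
rewrite /prob cube_intE; last first.
  apply: (@bounded_measurable_ranking R I (fun M => ((size M)%:R < a)%R%:R) 1) => x.
  by rewrite /= ler0n lern1 leq_b1.
(* For an empty matching the event is impossible, while the bound is positive. *)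
rewrite lte_fin; have [M0|M0] := posnP (size M).
  rewrite (_ : (fun x : nat -> R => _) = fun=> 0); first by rewrite mean_cst expR_gt0.
  by apply/funext => x; rewrite /a M0 mulr0 ltrn0.
(* The largest integer strictly below [a]: an integer size is below [a] exactly when it is at most
   [b]. *)
pose b : R := (Num.ceil a - 1)%:~R.
have ba : b < a by have /andP[] := ceil_itv a.
rewrite (_ : (fun x : nat -> R => _) =
             fun x : nat -> R => ((size (ranking I x))%:R <= b)%R%:R); last first.
  apply/funext => x; congr (nat_of_bool _)%:R.
  apply/idP/idP => [|/le_lt_trans]; last exact.
  by rewrite /b !pmulrn -ceil_gt_int ler_int lerBrDr lezD1.
have m0 : 0 < m by rewrite ltr0n.
pose t := comp_ratio R * m - b.
have at_ : alpha * m < t by move: ba; rewrite /t /a; lra.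
have am0 : 0 < alpha * m by rewrite mulr_gt0.
(* The minimiser of the exponent [- s * t + s ^+ 2 / 4 * m], whose minimum is [- (t ^+ 2 / m)];
   [alpha * m < t] then gives the strict bound. *)
have s0 : 0 <= 2 * t / m by rewrite divr_ge0 ?ltW ?mulr_gt0//; lra.
apply: (le_lt_trans (ranking_lower_tail b mM M0 s0)); rewrite ltr_expR -/m.
rewrite (_ : _ + _ = - (t ^+ 2 / m)); last by rewrite /t; field; rewrite gt_eqF.
rewrite ltrN2 ltr_pdivlMr// -mulrA -expr2 -exprMn.
by rewrite ltr_pXn2r// nnegrE; lra.
Qed.
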